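(* Fix integers $d\ge 1$ and $K>2$. Then there exists a constant $C(d,K)>0$ depending only on $d$ and $K$ such that for every $n\ge 1$ and every function $f:\Omega_K^n\to\mathbf{C}$ of degree at most $d$, $$f(z)=\sum_{\alpha\in\{0,1,\dots,K-1\}^n,\ |\alpha|\le d}a_\alpha z^\alpha,\qquad z\in\Omega_K^n,$$ we have $$\left(\sum_{|\alpha|\le d}|a_\alpha|^{\frac{2d}{d+1}}\right)^{\frac{d+1}{2d}}\le C(d,K)\,\|f\|_{\Omega_K^n}.$$ If $K$ is prime, we may choose $C(d,K)=C_K^{d^2}$ for some constant $C_K$ depending only on $K$.
   Context: $\Omega_K=\{1,\omega,\dots,\omega^{K-1}\}$ with $\omega=e^{2\pi i/K}$ is the multiplicative cyclic group of order $K$. Every $f:\Omega_K^n\to\mathbf{C}$ has a unique Fourier expansion $f(z)=\sum_{\alpha\in\{0,1,\dots,K-1\}^n}a_\alpha z^\alpha$ with $a_\alpha\in\mathbf{C}$, where $z^\alpha=z_1^{\alpha_1}\cdots z_n^{\alpha_n}$. Put $|\alpha|=\alpha_1+\dots+\alpha_n$ (sum of integers in $\{0,\dots,K-1\}$, not mod $K$). $f$ is of degree at most $d$ if $a_\alpha=0$ whenever $|\alpha|>d$. $\|f\|_{\Omega_K^n}=\sup_{z\in\Omega_K^n}|f(z)|$. *)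

(* Defs.v *)
(* The complex numbers are R[i], for R : realType. *)
From HB Require Import structures.
From mathcomp Require Import all_boot all_order all_algebra.
From mathcomp Require Import all_classical all_reals all_analysis.
From mathcomp Require Import complex.

Set Implicit Arguments.
Unset Strict Implicit.
Unset Printing Implicit Defensive.

Import Order.TTheory GRing.Theory Num.Theory.

Local Open Scope classical_set_scope.
Local Open Scope ring_scope.

Definition omega (R : realType) (K : nat) : R[i] :=
  (cos (2 * pi / K%:R) +i* sin (2 * pi / K%:R))%C.

Definition Omega (R : realType) (K : nat) : finType :=
  seq_sub [seq omega R K ^+ k | k <- iota 0 K].

Definition multi_index (n K : nat) : finType := {ffun 'I_n -> 'I_K}.

(* |alpha|, a sum of natural numbers, not reduced modulo K *)
Definition mdeg (n K : nat) (alpha : multi_index n K) : nat :=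
  (\sum_(i < n) (alpha i : nat))%N.

Definition monomial (R : realType) (n K : nat) (alpha : multi_index n K)
    (z : {ffun 'I_n -> Omega R K}) : R[i] :=
  \prod_(i < n) val (z i) ^+ alpha i.

Definition fourier_expansion (R : realType) (n K : nat)
    (f : {ffun 'I_n -> Omega R K} -> R[i]) (a : multi_index n K -> R[i]) : Prop :=
  forall z, f z = \sum_alpha a alpha * monomial alpha z.

(* The Fourier expansion being unique, this is the vanishing of the Fourier
   coefficients of f of index alpha with |alpha| > d. *)
Definition degree_at_most (R : realType) (n K : nat) (d : nat)
    (f : {ffun 'I_n -> Omega R K} -> R[i]) : Prop :=
  exists2 a, fourier_expansion f a &
    forall alpha, (d < mdeg alpha)%N -> a alpha = 0.

(* [normc] is the R-valued modulus; `|_| on R[i] is R[i]-valued. *)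
Definition sup_norm (R : realType) (n K : nat)
    (f : {ffun 'I_n -> Omega R K} -> R[i]) : R :=
  sup [set Normc.normc (f z) | z in [set: {ffun 'I_n -> Omega R K}]].

Definition BH_inequality (R : realType) (d K : nat) (C : R) : Prop :=
  forall (n : nat) (f : {ffun 'I_n -> Omega R K} -> R[i])
         (a : multi_index n K -> R[i]),
    (1 <= n)%N ->
    degree_at_most d f ->
    (forall z, f z = \sum_(alpha | (mdeg alpha <= d)%N) a alpha * monomial alpha z) ->
    (\sum_(alpha | (mdeg alpha <= d)%N)
        Normc.normc (a alpha) `^ (2 * d%:R / (d%:R + 1)))
      `^ ((d%:R + 1) / (2 * d%:R))
    <= C * sup_norm f.

(* Main.v *)
(* For z fixed and E a set of coordinates, averaging f over the measures
   t delta_(z_i) + (1 - t) uniform in the coordinates of E gives the polynomial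
   \sum_alpha a_alpha z^alpha t^|supp alpha :&: E|, bounded by ||f|| on [0, 1];
   its degree is at most d, so its derivative at 1 is at most C^(d^2) ||f||.
   This derivative is \sum_(i in E) L_i f(z), where L_i f is the part of f
   depending on z_i. Choosing E by the signs of the real and imaginary parts of
   L_i f(z) yields \sum_i |L_i f(z)| <= C^(d^2) ||f|| for every z.
   By hypercontractivity ||L_i f||_2 <= C_K^d ||L_i f||_1, hence
   \sum_i ||L_i f||_2 <= C_K^(d^2) ||f||, and an inequality of Blei type, here a
   consequence of AM-GM, turns this into the bound on the coefficients. *)

Require Import Defs.
From mathcomp Require Import all_boot all_order all_algebra.
From mathcomp Require Import all_classical all_reals all_analysis.
From mathcomp Require Import complex ring lra.

Set Implicit Arguments.
Unset Strict Implicit.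
Unset Printing Implicit Defensive.

Import Order.TTheory GRing.Theory Num.Theory.

Local Open Scope ring_scope.
Local Open Scope complex_scope.

Local Notation normc := Normc.normc.
Local Notation Re := complex.Re.
Local Notation Im := complex.Im.

(** * Real inequalities *)

Section RealInequalities.
Variable R : realType.

(** Induction on the degree: a combination of P(t) and P(t/2) cancels the top coefficient, which the
    value at t = 1 then recovers from the others. Each step costs a factor exponential in d, whence
    the exponent d^2. *)
Lemma coef_le_sup d (c : nat -> R) B :
  (forall t : R, 0 <= t <= 1 -> `|\sum_(k < d.+1) c k * t ^+ k| <= B) ->
  forall k, (k <= d)%N -> `|c k| <= 16 ^+ (d ^ 2) * B.
Proof.
elim: d c B => [|d IH] c B hB k hk.
  have := hB 0; rewrite big_ord_recl big_ord0 addr0 expr0 mulr1 /= lexx ler01.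
  by move: hk; rewrite leqn0 => /eqP ->; rewrite expr0 mul1r; apply.
have B0 : 0 <= B by apply: le_trans (hB 0 _); rewrite ?normr_ge0 ?lexx ?ler01.
(* 2^(d+1) P(t/2) - P(t) has no term of degree d+1. *)
pose c' j := c j * (2 ^+ (d.+1 - j) - 1).
have bnd' t : 0 <= t <= 1 ->
    `|\sum_(j < d.+1) c' j * t ^+ j| <= (2 ^+ d.+1 + 1) * B.
  move=> /andP[t0 t1].
  have -> : \sum_(j < d.+1) c' j * t ^+ j =
      2 ^+ d.+1 * (\sum_(j < d.+2) c j * (t / 2) ^+ j) -
      \sum_(j < d.+2) c j * t ^+ j.
    rewrite mulr_sumr -sumrB [RHS]big_ord_recr /=.
    rewrite expr_div_n [_ * (c _ * _)]mulrCA [_ * (_ / _)]mulrC divfK ?expf_neq0 // subrr addr0.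
    apply: eq_bigr => j _; rewrite /c' expr_div_n.
    have -> : 2 ^+ d.+1 = 2 ^+ (d.+1 - j) * 2 ^+ j :> R.
      by rewrite -exprD subnK // (leq_trans _ (leqnSn _)) // -ltnS ltn_ord.
    by field; rewrite expf_neq0.
  apply: le_trans (ler_normB _ _) _; rewrite normrM [`|2 ^+ _|]ger0_norm ?exprn_ge0 //.
  rewrite mulrDl mul1r; apply: lerD; last by apply: hB; rewrite t0.
  by apply: ler_wpM2l; [rewrite exprn_ge0 | apply: hB; apply/andP; split; lra].
have e2 n : 1 <= 2 ^+ n :> R by rewrite exprn_ege1 ?ler1n.
set g := 16 ^+ (d ^ 2) in IH *.
have low j : (j <= d)%N -> `|c j| <= g * ((2 ^+ d.+1 + 1) * B).
  move=> hj; apply: le_trans (IH _ _ bnd' j hj).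
  (* The factor 2^(d+1-j) - 1 is at least 1 for j <= d, so [c' j] dominates [c j]. *)
  rewrite /c' normrM ler_peMr ?normr_ge0 // ger0_norm ?subr_ge0 //.
  by rewrite subSn // exprS; have := e2 (d - j)%N; lra.
have top : `|c d.+1| <= B + d.+1%:R * (g * ((2 ^+ d.+1 + 1) * B)).
  have := hB 1; rewrite ler01 lexx big_ord_recr /= expr1n mulr1.
  set s := \sum_(i < _) _ => /(_ isT) hs.
  have -> : c d.+1 = (s + c d.+1) - s by ring.
  apply: le_trans (ler_normB _ _) _; apply: lerD => //.
  apply: le_trans (ler_norm_sum _ _ _) _.
  apply: le_trans (ler_sum _ (G := fun=> g * ((2 ^+ d.+1 + 1) * B)) _) _.
    by move=> j _; rewrite expr1n mulr1; apply: low; rewrite -ltnS.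
  by rewrite sumr_const card_ord -[leLHS]mulr_natl lexx.
have g1 : 1 <= g by rewrite /g exprn_ege1 ?ler1n.
have big : B + d.+1%:R * (g * ((2 ^+ d.+1 + 1) * B)) <= 16 ^+ (d.+1 ^ 2) * B.
  (* Passing from d^2 to (d+1)^2 brings the factor 16 * (2^d)^8, while the recursion costs at most 1
     + 6 * (2^d)^2, as d+1 <= 2 * 2^d. *)
  have -> : 16 ^+ (d.+1 ^ 2) = g * (16 * (2 ^+ d) ^+ 8) :> R.
    have -> : (2 ^+ d) ^+ 8 = 16 ^+ (d * 2) :> R.
      rewrite -exprM (_ : (d * 8 = 4 * (d * 2))%N); last by ring.
      by rewrite exprM; congr (_ ^+ _); ring.
    by rewrite -exprS -exprD; congr (_ ^+ _); ring.
  have hd : d.+1%:R <= 2 * 2 ^+ d :> R.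
    by rewrite -exprS -natrX ler_nat ltnW // ltn_expl.
  have := e2 d; rewrite (exprS _ d); set e := 2 ^+ d in hd * => he.
  have e8 : e ^+ 2 <= e ^+ 8 by rewrite ler_weXn2l.
  have h1 : d.+1%:R * (2 * e + 1) <= 6 * e ^+ 2.
    apply: le_trans (ler_wpM2r _ hd) _; first lra.
    have : e <= e * e by apply: ler_peMr => //; lra.
    by rewrite expr2; lra.
  have e1 : 1 <= e ^+ 8 by rewrite exprn_ege1.
  have -> : B + d.+1%:R * (g * ((2 * e + 1) * B)) =
     (1 + g * (d.+1%:R * (2 * e + 1))) * B by ring.
  rewrite ler_wpM2r //; apply: le_trans (_ : g + g * (6 * e ^+ 8) <= _).
    apply: lerD => //; apply: ler_wpM2l; [lra | apply: le_trans h1 _; lra].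
  by rewrite -{1}[g]mulr1 -mulrDr ler_wpM2l; lra.
move: hk; rewrite leq_eqVlt ltnS => /orP[/eqP -> | hk].
  exact: le_trans top big.
apply: le_trans (low _ hk) _; apply: le_trans big.
rewrite -[leLHS]add0r lerD // ler_peMl ?ler1n // !mulr_ge0 //; lra.
Qed.

(** The sum is the derivative at 1; each of its d nonconstant terms is at most d * 16^(d^2) * B. *)
Lemma deriv1_le_sup d (c : nat -> R) B :
  (forall t : R, 0 <= t <= 1 -> `|\sum_(k < d.+1) c k * t ^+ k| <= B) ->
  `|\sum_(k < d.+1) c k * k%:R| <= (d ^ 2).+1%:R * 16 ^+ (d ^ 2) * B.
Proof.
move=> hB; have B0 : 0 <= B by apply: le_trans (hB 0 _); rewrite ?normr_ge0 ?lexx ?ler01.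
have g0 : 0 <= 16 ^+ (d ^ 2) * B by rewrite mulr_ge0 ?exprn_ge0.
apply: le_trans (ler_norm_sum _ _ _) _; rewrite big_ord_recl mulr0 normr0 add0r.
apply: le_trans (ler_sum _ (G := fun=> 16 ^+ (d ^ 2) * B * d%:R) _) _.
  move=> j _; rewrite normrM normr_nat; apply: ler_pM => //.
    by apply: coef_le_sup => //; rewrite lift0.
  by rewrite lift0 ler_nat.
rewrite sumr_const card_ord -[leLHS]mulr_natr -[leRHS]mulrA.
rewrite [leLHS](_ : _ = (d ^ 2)%:R * (16 ^+ (d ^ 2) * B)); last first.
  by rewrite natrX; ring.
by rewrite ler_wpM2r // ler_nat.
Qed.

Lemma sum_CauchySchwarz (J : finType) (x y : J -> R) A B : 0 <= A -> 0 <= B ->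
  \sum_j x j ^+ 2 <= A ^+ 2 -> \sum_j y j ^+ 2 <= B ^+ 2 ->
  \sum_j x j * y j <= A * B.
Proof.
move=> A0 B0 hx hy.
have sq0 C (w : J -> R) : C = 0 -> \sum_j w j ^+ 2 <= C ^+ 2 -> forall j, w j = 0.
  move=> -> hw j; apply/eqP; rewrite -sqrf_eq0 eq_le sqr_ge0 andbT.
  apply: le_trans (le_trans hw _); last by rewrite expr0n.
  by rewrite (bigD1 j) //= lerDl sumr_ge0 // => *; rewrite sqr_ge0.
have [A00|A00] := eqVneq A 0.
  by rewrite big1 ?mulr_ge0 // => j _; rewrite (sq0 _ _ A00 hx) mul0r.
have [B00|B00] := eqVneq B 0.
  by rewrite big1 ?mulr_ge0 // => j _; rewrite (sq0 _ _ B00 hy) mulr0.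
have AB : 0 < A * B by rewrite mulr_gt0 // lt_neqAle eq_sym ?A00 ?B00.
rewrite -(ler_pM2l AB) mulr_sumr -(ler_pM2l (_ : 0 < 2 :> R)) // mulr_sumr.
(* AM-GM in each term, from the square (B x - A y)^2, weighted so that nothing is divided by A or
   B. *)
apply: le_trans (_ : B ^+ 2 * (\sum_j x j ^+ 2) + A ^+ 2 * \sum_j y j ^+ 2 <= _).
  rewrite !mulr_sumr -big_split /=; apply: ler_sum => j _.
  by rewrite -subr_ge0 (_ : _ - _ = (B * x j - A * y j) ^+ 2) ?sqr_ge0 //; ring.
have := ler_wpM2l (sqr_ge0 B) hx; have := ler_wpM2l (sqr_ge0 A) hy; lra.
Qed.

Lemma sqr_sum_le (J : finType) (x : J -> R) :
  (\sum_j x j) ^+ 2 <= #|J|%:R * \sum_j x j ^+ 2.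
Proof.
have p0 : 0 <= #|J|%:R * \sum_j x j ^+ 2 by rewrite mulr_ge0 // sumr_ge0 // => *; rewrite sqr_ge0.
have s0 : 0 <= \sum_j x j ^+ 2 by rewrite sumr_ge0 // => *; rewrite sqr_ge0.
have h : \sum_j 1 * `|x j| <= Num.sqrt #|J|%:R * Num.sqrt (\sum_j x j ^+ 2).
  apply: sum_CauchySchwarz; rewrite ?sqrtr_ge0 // sqr_sqrtr //.
    by under eq_bigr do rewrite expr1n; rewrite sumr_const.
  by under eq_bigr do rewrite real_normK ?num_real //.
have h2 : `|\sum_j x j| <= Num.sqrt #|J|%:R * Num.sqrt (\sum_j x j ^+ 2).
  apply: le_trans (ler_norm_sum _ _ _) _; apply: le_trans h.
  by under [leRHS]eq_bigr do rewrite mul1r.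
rewrite -[_ ^+ 2]real_normK ?num_real //.
apply: le_trans (_ : _ <= (Num.sqrt #|J|%:R * Num.sqrt (\sum_j x j ^+ 2)) ^+ 2) _.
  by rewrite lerXn2r ?nnegrE ?mulr_ge0 ?sqrtr_ge0.
by rewrite exprMn !sqr_sqrtr.
Qed.

Lemma prod_1D_le_expR (J : finType) (x : J -> R) : (forall j, 0 <= x j) ->
  \prod_j (1 + x j) <= expR (\sum_j x j).
Proof.
move=> x0; rewrite expR_sum; apply: ler_prod => j _.
by rewrite addr_ge0 //= expR_ge1Dx.
Qed.

End RealInequalities.

(** * Blei's inequality *)

Lemma big_option (S : Type) (idx : S) (op : Monoid.com_law idx) (J : finType)
    (F : option J -> S) :
  \big[op/idx]_(o : option J) F o = op (F None) (\big[op/idx]_j F (Some j)).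
Proof.
rewrite (bigD1 None) //=; congr (op _ _).
rewrite (reindex_omap Some id) => [|[]] //.
by apply: eq_bigl => j; rewrite eqxx.
Qed.

Section SupportSize.
Variables (I : finType) (k : nat).
Implicit Type alpha : {ffun I -> 'I_k.+1}.

(** This replaces the degree for a general orthonormal system, whose indices carry no exponents. *)
Definition supp_size alpha := #|[pred i | alpha i != ord0]|.

End SupportSize.

Section Blei.
Variables (R : realType) (I : finType) (k d : nat).
Implicit Type alpha : {ffun I -> 'I_k.+1}.
Variable b : {ffun I -> 'I_k.+1} -> R.
Hypothesis b_ge0 : forall alpha, 0 <= b alpha.
Hypothesis b_le1 : forall alpha, b alpha <= 1.
Hypothesis d_gt0 : (0 < d)%N.
Hypothesis b_deg : forall alpha, (d < supp_size alpha)%N -> b alpha = 0.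

(** When [b] is the modulus of the coefficients of f, this is the L2 norm of L_i f by Parseval. *)
Let B i := Num.sqrt (\sum_(alpha : {ffun I -> 'I_k.+1} | alpha i != ord0) b alpha ^+ 2).

Let B_ge0 i : 0 <= B i. Proof. exact: sqrtr_ge0. Qed.

Let b_le_B alpha i : alpha i != ord0 -> b alpha <= B i.
Proof.
move=> hi; rewrite -[b alpha]ger0_norm // -sqrtr_sqr ler_wsqrtr //.
by rewrite (bigD1 alpha) //= lerDl sumr_ge0 // => *; rewrite sqr_ge0.
Qed.

(* AM-GM for the supp_size alpha + 1 numbers b^2 / B i and \prod_i B i, whose
   product is b^(2 * supp_size alpha). *)
Lemma blei_pointwise alpha :
  b alpha `^ (2 * d%:R / (d%:R + 1)) <=
  \sum_(i | alpha i != ord0) b alpha ^+ 2 / B i + \prod_(i | alpha i != ord0) B i.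
Proof.
have d1 : 0 < d%:R + 1 :> R by rewrite natr1 ltr0n.
have S0 : 0 <= \sum_(i | alpha i != ord0) b alpha ^+ 2 / B i +
               \prod_(i | alpha i != ord0) B i.
  rewrite addr_ge0 ?sumr_ge0 ?prodr_ge0 // => i _.
  by rewrite mulr_ge0 ?invr_ge0 ?sqr_ge0.
have [b0|b0] := eqVneq (b alpha) 0.
  by rewrite {1}b0 powR0 // mulf_neq0 ?invr_eq0 ?gt_eqF ?mulr_gt0 ?ltr0n.
have bpos : 0 < b alpha by rewrite lt_neqAle eq_sym b0 b_ge0.
set m := supp_size alpha.
have hm : (m <= d)%N by rewrite leqNgt; apply: contra b0 => /b_deg ->.
have m1 : 0 < m%:R + 1 :> R by rewrite natr1 ltr0n.
(* AM-GM yields the exponent 2m/(m+1), where m is the support size; as m <= d and b <= 1, the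
   exponent for d gives a smaller power. *)
apply: le_trans (_ : b alpha `^ (2 * m%:R / (m%:R + 1)) <= _).
  apply: ger_powR; first by rewrite bpos b_le1.
  rewrite ler_pdivrMr // mulrAC ler_pdivlMr //.
  have : m%:R <= d%:R :> R by rewrite ler_nat.
  nra.
(* The m numbers b^2 / B i sit at [Some i], and [None] carries the extra factor that cancels the
   denominators. *)
pose A := [pred o : option I | if o is Some i then alpha i != ord0 else true].
pose E o := if o is Some i then b alpha ^+ 2 / B i
            else \prod_(i | alpha i != ord0) B i.
have cA : #|A| = m.+1.
  rewrite -sum1_card big_mkcond big_option /= -big_mkcond /= sum1_card.
  by rewrite add1n.
have E0 : {in A, forall o, 0 <= E o}.
  move=> [i|] _ /=; last by rewrite prodr_ge0.
  by rewrite mulr_ge0 ?invr_ge0 ?sqr_ge0.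
have sE : \sum_(o in A) E o = \sum_(i | alpha i != ord0) b alpha ^+ 2 / B i +
               \prod_(i | alpha i != ord0) B i.
  by rewrite big_mkcond big_option /= -big_mkcond addrC.
have pE : \prod_(o in A) E o = (b alpha ^+ 2) ^+ m.
  rewrite big_mkcond big_option /= -big_mkcond /= -big_split /=.
  rewrite (eq_bigr (fun=> b alpha ^+ 2)) ?prodr_const // => i hi.
  by rewrite mulrCA mulfV ?mulr1 // gt_eqF // (lt_le_trans bpos) ?b_le_B.
have [+ _] := leif_AGM E0; rewrite pE cA sE; move: S0; set S := _ + _ => S0.
move=> hAG.
have hS : (b alpha ^+ 2) ^+ m <= S ^+ m.+1.
  apply: le_trans hAG _; rewrite lerXn2r ?nnegrE ?divr_ge0 //.
  by rewrite ler_pdivrMr ?ltr0n // ler_peMr // ler1n.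
rewrite -(@ler_pXn2r _ m.+1) ?nnegrE ?powR_ge0 //.
rewrite -powR_mulrn ?powR_ge0 // -powRrM -[m.+1%:R]natr1 divfK ?gt_eqF //.
by rewrite -natrM powR_mulrn // exprM.
Qed.

(** Summed over alpha, the terms b^2 / B i with alpha i nonzero give B i, hence at most 1 in all.
    The products over the supports sum to the product of the 1 + k B i, which is at most exp (k
    \sum_i B i). *)
Lemma blei : \sum_i B i <= 1 ->
  \sum_alpha b alpha `^ (2 * d%:R / (d%:R + 1)) <= 1 + expR k%:R.
Proof.
move=> hB; apply: le_trans (ler_sum _ (fun alpha _ => blei_pointwise alpha)) _.
rewrite big_split /=; apply: lerD.
  apply: le_trans hB; rewrite (exchange_big_dep predT) //=; apply: ler_sum => i _.
  rewrite -mulr_suml -(sqr_sqrtr (_ : 0 <= \sum_(a : {ffun I -> 'I_k.+1} | a i != ord0) b a ^+ 2)).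
    rewrite -/(B i) expr2; have [->|h] := eqVneq (B i) 0; first by rewrite mul0r mul0r.
    by rewrite mulfK.
  by rewrite sumr_ge0 // => *; rewrite sqr_ge0.
under eq_bigr do rewrite big_mkcond /=.
rewrite -(bigA_distr_bigA (fun i (v : 'I_k.+1) => if v != ord0 then B i else 1)).
apply: le_trans (_ : expR (\sum_i (k%:R * B i)) <= _).
  apply: le_trans (prod_1D_le_expR _); last by move=> i; rewrite mulr_ge0.
  rewrite le_eqVlt; apply/orP; left; apply/eqP; apply: eq_bigr => i _.
  rewrite big_ord_recl /=; congr (_ + _).
  by rewrite (eq_bigr (fun=> B i)) // sumr_const card_ord mulr_natl.
by rewrite ler_expR -mulr_sumr ler_piMr.
Qed.

End Blei.

(** * Orthonormal systems and the noise operator *)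

Section ComplexModulus.
Variable R : realType.
Implicit Types x y : R[i].

Lemma sqr_normcE x : normc x ^+ 2 = Re x ^+ 2 + Im x ^+ 2.
Proof. by case: x => a b; rewrite sqr_sqrtr // addr_ge0 ?sqr_ge0. Qed.

Lemma sqr_normcJ x : (normc x ^+ 2)%:C = x * x^*.
Proof. by rewrite -sqr_normc normc_def rmorphXn; case: x. Qed.

Lemma normc_ge0 x : 0 <= normc x.
Proof. by case: x => a b; exact: sqrtr_ge0. Qed.

Lemma normcD_le x y : normc (x + y) <= normc x + normc y.
Proof. exact: le_normcD. Qed.

Lemma normc_sum_le (J : Type) (r : seq J) (P : pred J) (F : J -> R[i]) :
  normc (\sum_(j <- r | P j) F j) <= \sum_(j <- r | P j) normc (F j).
Proof.
elim/big_ind2: _ => [|x1 x2 y1 y2 h1 h2|//]; first by rewrite Normc.normc0.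
exact: le_trans (normcD_le _ _) (lerD h1 h2).
Qed.

Lemma normc_real (a : R) : normc a%:C = `|a|.
Proof. by rewrite /= expr0n /= addr0 sqrtr_sqr. Qed.

Lemma Re_le_normc x : `|Re x| <= normc x.
Proof.
rewrite -sqrtr_sqr; case: x => a b /=.
by rewrite ler_wsqrtr // lerDl sqr_ge0.
Qed.

Lemma normc_le_ReIm x : normc x <= `|Re x| + `|Im x|.
Proof.
rewrite -(@ler_pXn2r _ 2) ?nnegrE ?addr_ge0 ?normc_ge0 //.
rewrite sqr_normcE sqrrD !real_normK ?num_real //.
by rewrite -addrA lerD2l lerDr mulrn_wge0 // mulr_ge0.
Qed.

(* The first-order term Re (x^* * y) is kept exact: it averages out when y does. *)
Lemma normc_add_exp4 x y :
  normc (x + y) ^+ 4 <= normc x ^+ 4 + 4 * (normc x ^+ 2 * Re (x^* * y))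
                        + 8 * (normc x ^+ 2 * normc y ^+ 2) + 3 * normc y ^+ 4.
Proof.
have e4 (a : R) : a ^+ 4 = (a ^+ 2) ^+ 2 by rewrite -exprM.
rewrite !e4 !sqr_normcE.
case: x y => [a b] [c d] /=; set r := a * c - _.
set P := a ^+ 2 + _; set Q := c ^+ 2 + _.
have -> : (a + c) ^+ 2 + (b + d) ^+ 2 = P + Q + 2 * r by rewrite /P /Q /r; ring.
have hr : r ^+ 2 <= P * Q.
  rewrite -subr_ge0 (_ : _ - _ = (a * d - b * c) ^+ 2) ?sqr_ge0 //.
  by rewrite /P /Q /r; ring.
have PQ : 0 <= P * Q by apply: le_trans hr; rewrite sqr_ge0.
(* The difference of the two sides is 2 (Q - r)^2 + 6 (P Q - r^2). *)
have := sqr_ge0 (Q - r); clearbody P Q r; rewrite !expr2 in hr *; lra.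
Qed.

End ComplexModulus.

Section OrthonormalSystem.
Variables (R : realType) (T : finType) (k : nat) (e : 'I_k.+1 -> T -> R[i]).

(** The properties of the characters w^v of a cyclic group that the argument uses. Orthogonality is
    for the counting measure, hence the factor [#|T|]. *)
Definition bounded_orthonormal :=
  [/\ forall w, e ord0 w = 1,
      forall v w, normc (e v w) <= 1
    & forall u v, \sum_w e u w * (e v w)^* = (#|T| * (u == v))%:R].

Variable I : finType.
Implicit Types (alpha : {ffun I -> 'I_k.+1}) (z : {ffun I -> T}).
Implicit Types c : {ffun I -> 'I_k.+1} -> R[i].

Definition character alpha z : R[i] := \prod_i e (alpha i) (z i).

Definition expansion c z : R[i] := \sum_alpha c alpha * character alpha z.

Hypothesis eP : bounded_orthonormal.

Let e0 w : e ord0 w = 1. Proof. by case: eP. Qed.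
Let e_orth u v : \sum_w e u w * (e v w)^* = (#|T| * (u == v))%:R.
Proof. by case: eP. Qed.

Lemma sum_system v : \sum_w e v w = (#|T| * (v == ord0))%:R.
Proof. by rewrite -e_orth; apply: eq_bigr => w _; rewrite e0 rmorph1 mulr1. Qed.

Lemma parseval c : \sum_z normc (expansion c z) ^+ 2 =
  #|{ffun I -> T}|%:R * \sum_alpha normc (c alpha) ^+ 2.
Proof.
apply: complexI; rewrite rmorphM rmorph_nat !rmorph_sum mulr_sumr /=.
have orth alpha beta : \sum_z character alpha z * (character beta z)^* =
    (#|{ffun I -> T}| * (alpha == beta))%:R.
  under eq_bigr do rewrite rmorph_prod -big_split /=.
  rewrite -(bigA_distr_bigA (fun i w => e (alpha i) w * (e (beta i) w)^*)).
  under eq_bigr do rewrite e_orth.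
  rewrite -natr_prod; congr (_%:R); rewrite big_split /= prod_nat_const card_ffun.
  congr (_ * _)%N; have [->|ne] := eqVneq alpha beta.
    by rewrite big1 // => i _; rewrite eqxx.
  have [i hi] : exists i, alpha i != beta i.
    apply/existsP; apply: contraNT ne; rewrite negb_exists => /forallP h.
    by apply/eqP/ffunP => i; apply/eqP; rewrite -[_ == _]negbK.
  by rewrite (bigD1 i) //= (negbTE hi).
transitivity (\sum_z \sum_alpha \sum_beta
    c alpha * (c beta)^* * (character alpha z * (character beta z)^*)).
  apply: eq_bigr => z _; rewrite sqr_normcJ /expansion rmorph_sum mulr_suml.
  apply: eq_bigr => alpha _; rewrite mulr_sumr; apply: eq_bigr => beta _.
  by rewrite rmorphM; ring.
rewrite exchange_big; apply: eq_bigr => alpha _ /=.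
rewrite exchange_big (bigD1 alpha) //= [X in _ + X]big1 => [|beta ne].
  by rewrite -mulr_sumr orth eqxx muln1 sqr_normcJ addr0 mulrC.
by rewrite -mulr_sumr orth eq_sym (negbTE ne) muln0 mulr0.
Qed.

(* Averaging f over the product of the measures t delta_(z i) + (1 - t) uniform
   (i in E) and delta_(z i) (i notin E) multiplies each coefficient by
   t^|supp alpha :&: E|. *)
Lemma noise_le c (M : R) (E : {pred I}) z (t : R) :
  (forall y, normc (expansion c y) <= M) -> 0 <= t <= 1 ->
  normc (\sum_alpha c alpha * character alpha z *
           (t ^+ #|[pred i in E | alpha i != ord0]|)%:C) <= M.
Proof.
move=> hM /andP[t0 t1].
pose p i w : R := if i \in E then t * (w == z i)%:R + (1 - t) / #|T|%:R
                  else (w == z i)%:R.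
have TC0 (i : I) : #|T|%:R != 0 :> R[i].
  by rewrite pnatr_eq0 -lt0n; apply/card_gt0P; exists (z i).
have p0 i w : 0 <= p i w.
  by rewrite /p; case: ifP => _ //; rewrite addr_ge0 ?mulr_ge0 ?invr_ge0 ?subr_ge0.
have sdelta i (g : T -> R[i]) : \sum_w ((w == z i)%:R)%:C * g w = g (z i).
  rewrite (bigD1 (z i)) //= eqxx mul1r big1 ?addr0 // => w /negbTE ->.
  by rewrite mul0r.
(* Each e v is an eigenfunction of the averaging: nonconstant ones have mean zero, so only the point
   mass, of weight t, survives on E. *)
have pe i v : \sum_w (p i w)%:C * e v w =
    e v (z i) * (if (i \in E) && (v != ord0) then t else 1)%:C.
  rewrite /p; case: (i \in E) => /=; last by rewrite sdelta mulr1.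
  under eq_bigr do rewrite rmorphD rmorphM mulrDl -mulrA.
  rewrite big_split /= -mulr_sumr sdelta -mulr_sumr sum_system.
  have [->|nv] := eqVneq v ord0; last by rewrite muln0 mulr0 addr0 mulrC.
  rewrite muln1 rmorphM fmorphV rmorph_nat divfK ?(TC0 i) // e0 !mulr1 -rmorphD.
  by congr (_%:C); ring.
have mass : \sum_(y : {ffun I -> T}) \prod_i p i (y i) = 1.
  rewrite -(bigA_distr_bigA p) big1 // => i _; apply: complexI.
  transitivity (\sum_w (p i w)%:C * e ord0 w); last by rewrite pe e0 eqxx andbF mulr1.
  by rewrite rmorph_sum; apply: eq_bigr => w _; rewrite e0 mulr1.
have -> : \sum_alpha c alpha * character alpha z *
           (t ^+ #|[pred i in E | alpha i != ord0]|)%:C =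
    \sum_(y : {ffun I -> T}) (\prod_i p i (y i))%:C * expansion c y.
  under [RHS]eq_bigr do rewrite mulr_sumr.
  rewrite exchange_big; apply: eq_bigr => alpha _ /=.
  under [RHS]eq_bigr do rewrite mulrCA rmorph_prod /character -big_split /=.
  rewrite -mulr_sumr -mulrA; congr (_ * _).
  rewrite -(bigA_distr_bigA (fun i w => (p i w)%:C * e (alpha i) w)).
  under [RHS]eq_bigr do rewrite pe.
  rewrite big_split /=; congr (_ * _).
  by rewrite -rmorph_prod -big_mkcond /= prodr_const.
apply: le_trans (normc_sum_le _ _ _) _.
rewrite -[leRHS]mul1r -[1 in leRHS]mass mulr_suml; apply: ler_sum => y _.
have p1 : 0 <= \prod_i p i (y i) by apply: prodr_ge0.
by rewrite Normc.normcM normc_real ger0_norm // ler_wpM2l.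
Qed.

End OrthonormalSystem.

(** * The sum of the influences *)

(** The nonnegative terms and the negative ones form two subsums without cancellation. *)
Lemma sum_norm_le_subsums (R : realDomainType) (J : finType) (x : J -> R) D :
  (forall E : {pred J}, `|\sum_(j in E) x j| <= D) -> \sum_j `|x j| <= D *+ 2.
Proof.
move=> h; pose E := [pred j | 0 <= x j]; rewrite (bigID (mem E)) /= mulr2n.
apply: lerD; [have := h E | have := h [predC E]]; apply: le_trans.
  apply: le_trans (ler_norm _); apply: ler_sum => j; rewrite inE => hj.
  by rewrite ger0_norm.
rewrite -normrN -sumrN; apply: le_trans (ler_norm _); apply: ler_sum => j.
by rewrite !inE -ltNge => hj; rewrite ltr0_norm.
Qed.

Section Derivative.
Variables (R : realType) (T I : finType) (k d : nat) (e : 'I_k.+1 -> T -> R[i]).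
Hypothesis eP : bounded_orthonormal e.
Implicit Types (alpha : {ffun I -> 'I_k.+1}) (z : {ffun I -> T}).
Implicit Types c : {ffun I -> 'I_k.+1} -> R[i].

(* Coefficients of L_i f = f - E_i f, where E_i averages over the i-th coordinate. *)
Definition coord_part i c alpha : R[i] := if alpha i != ord0 then c alpha else 0.

Let D : R := (d ^ 2).+1%:R * 16 ^+ (d ^ 2).

(** Grouping the indices by level exhibits a sum over alpha as a polynomial of degree at most d,
    evaluated through g j = t^j or differentiated at 1 through g j = j. *)
Let sum_levels (s : {ffun I -> 'I_k.+1} -> nat) (g : nat -> R)
    (w : {ffun I -> 'I_k.+1} -> R) : (forall alpha, (d < s alpha)%N -> w alpha = 0) ->
  \sum_(j < d.+1) (\sum_(alpha | s alpha == j) w alpha) * g j =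
  \sum_alpha w alpha * g (s alpha).
Proof.
move=> hw; under eq_bigr do rewrite mulr_suml.
rewrite (exchange_big_dep predT) //=; apply: eq_bigr => alpha _.
have [hs|hs] := ltnP d (s alpha).
  by rewrite hw // mul0r big1 // => j _; rewrite mul0r.
by rewrite (big_pred1 (Ordinal (hs : (s alpha < d.+1)%N))).
Qed.

(** The real part of the averaged expansion is a real polynomial in t, bounded by M on [0, 1]. An
    index of level j lies in exactly j of the parts L_i f with i in E, so the derivative at 1 is the
    sum in question. *)
Lemma sum_Re_coord_part_le c (M : R) (E : {pred I}) z :
  (forall alpha, (d < supp_size alpha)%N -> c alpha = 0) ->
  (forall y, normc (expansion e c y) <= M) ->
  `|\sum_(i in E) Re (expansion e (coord_part i c) z)| <= D * M.
Proof.
move=> hd hM; pose s alpha := #|[pred i in E | alpha i != ord0]|.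
pose w alpha := Re (c alpha * character e alpha z).
have hw alpha : (d < s alpha)%N -> w alpha = 0.
  move=> h; rewrite /w hd ?mul0r //; apply: leq_trans h _.
  by apply: subset_leq_card; apply/fintype.subsetP => i; rewrite !inE => /andP[].
pose u j := \sum_(alpha | s alpha == j) w alpha.
have <- : \sum_(j < d.+1) u j * j%:R =
    \sum_(i in E) Re (expansion e (coord_part i c) z).
  rewrite (sum_levels (fun j => j%:R) hw).
  transitivity (\sum_alpha \sum_(i in E) w alpha * (alpha i != ord0)%:R).
    apply: eq_bigr => alpha _; rewrite -mulr_sumr -natr_sum; congr (_ * _%:R).
    by rewrite /s -sum1_card big_mkcondr.
  rewrite exchange_big; apply: eq_bigr => i _; rewrite raddf_sum.
  apply: eq_bigr => alpha _; rewrite /coord_part /w.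
  by case: ifP => _; rewrite ?mulr1 ?mulr0 ?mul0r.
apply: deriv1_le_sup => t ht.
rewrite (sum_levels (fun j => t ^+ j) hw).
apply: le_trans (noise_le eP E z hM ht); apply: le_trans (Re_le_normc _).
rewrite raddf_sum le_eqVlt; apply/orP; left; apply/eqP; congr `|_|.
apply: eq_bigr => alpha _; rewrite /w -/(s alpha).
by case: (_ * character _ _ _) => a b /=; rewrite mulr0 subr0.
Qed.

Lemma sum_normc_coord_part_le c (M : R) z :
  (forall alpha, (d < supp_size alpha)%N -> c alpha = 0) ->
  (forall y, normc (expansion e c y) <= M) ->
  \sum_i normc (expansion e (coord_part i c) z) <= 4 * (D * M).
Proof.
move=> hd hM; apply: le_trans (ler_sum _ (fun i _ => normc_le_ReIm _)) _.
(* The constant 4 is a factor 2 for the signs, once for the real and once for the imaginary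
   parts. *)
rewrite big_split /= -[4]/(2 + 2)%:R natrD mulrDl !mulr_natl.
apply: lerD; apply: sum_norm_le_subsums => E; first exact: sum_Re_coord_part_le.
(* Multiplying f by 'i turns imaginary parts into real ones up to sign and preserves the bound M. *)
pose c' alpha := c alpha * 'i.
have ce c0 y : expansion e (fun alpha => c0 alpha * 'i) y = expansion e c0 y * 'i.
  by rewrite /expansion mulr_suml; apply: eq_bigr => alpha _; rewrite mulrAC.
rewrite -normrN -sumrN.
have -> : \sum_(i in E) - Im (expansion e (coord_part i c) z) =
          \sum_(i in E) Re (expansion e (coord_part i c') z).
  apply: eq_bigr => i _; rewrite -ReiNIm -ce; congr Re.
  apply: eq_bigr => alpha _; congr (_ * _); rewrite /coord_part /c'.
  by case: ifP => // _; rewrite mul0r.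
apply: sum_Re_coord_part_le => [alpha /hd h|y]; first by rewrite /c' h mul0r.
rewrite ce Normc.normcM (_ : normc 'i = 1) ?mulr1 //.
by rewrite /= expr0n /= add0r expr1n sqrtr1.
Qed.

End Derivative.

(** * Hypercontractivity *)

Section Hypercontractivity.
Variables (R : realType) (T I : finType) (k : nat) (e : 'I_k.+1 -> T -> R[i]).
Hypothesis eP : bounded_orthonormal e.
Local Notation Z := {ffun I -> T}.
Implicit Types (alpha beta : {ffun I -> 'I_k.+1}) (z : Z) (i : I) (s : seq I).
Implicit Types c : {ffun I -> 'I_k.+1} -> R[i].

(* With K = k.+1, the induction step only needs 8 K <= 2 L and 3 K^3 <= L^2. *)
Let L : R := 4 * k.+1%:R ^+ 2.

Definition update z i w : Z := [ffun j => if j == i then w else z j].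

(** On each fibre where only the i-th coordinate varies, phi is constant and psi sums to 0. *)
Lemma sum_mean_zero i (phi : Z -> R[i]) (psi : T -> R[i]) :
  (forall z w, phi (update z i w) = phi z) -> \sum_w psi w = 0 ->
  \sum_z phi z * psi (z i) = 0.
Proof.
move=> hphi hpsi; have [w0 _|noT] := pickP (fun _ : T => true); last first.
  by rewrite big1 // => z _; move: (noT (z i)).
(* A fibre is labelled by its point with i-th coordinate [w0]. *)
rewrite (partition_big (fun z => update z i w0) predT) //= big1 // => y _.
rewrite (eq_bigr (fun z => phi y * psi (z i))) => [|z /eqP <-]; last by rewrite hphi.
have [[z0 /eqP hz0]|no] := pselect (exists z, update z i w0 == y); last first.
  by rewrite big1 // => z hz; case: no; exists z.
have ext z j : update z i w0 == y -> j != i -> z j = z0 j.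
  move=> /eqP hz ji; have /ffunP/(_ j) : update z i w0 = update z0 i w0 by rewrite hz hz0.
  by rewrite !ffunE (negbTE ji).
have upd w : (update (update z0 i w) i w0 == y).
  by rewrite -hz0; apply/eqP/ffunP => j; rewrite !ffunE; case: (j == i).
rewrite -mulr_sumr (reindex_onto (update z0 i) (fun z => z i)) /=; last first.
  move=> z hz; apply/ffunP => j; rewrite ffunE; case: eqP => [->//|/eqP ji].
  by rewrite (ext z j hz ji).
rewrite (eq_bigl predT) => [|w]; last by rewrite upd ffunE eqxx eqxx.
by rewrite (eq_bigr psi) ?hpsi ?mulr0 // => w _; rewrite ffunE eqxx.
Qed.

(** The function splits as g + H, with g independent of the i-th coordinate and H of mean zero in
    it. In the fourth moment the first-order term vanishes, the mixed term is bounded by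
    Cauchy-Schwarz, and the factor [L] on the nonconstant part absorbs the constants. *)
Lemma hypercontractive_step i (h : 'I_k.+1 -> Z -> R[i]) (N : 'I_k.+1 -> R) :
  (forall v z w, h v (update z i w) = h v z) ->
  (forall v, 0 <= N v) ->
  (forall v, \sum_(z : Z) normc (h v z) ^+ 4 <= #|Z|%:R * N v ^+ 2) ->
  \sum_(z : Z) normc (\sum_v e v (z i) * h v z) ^+ 4 <=
  #|Z|%:R * (\sum_v L ^+ (v != ord0) * N v) ^+ 2.
Proof.
move=> hind N0 hN; have [e0 e_le1 _] := eP.
set g := h ord0; set K : R := k.+1%:R.
have K1 : 1 <= K by rewrite ler1n.
pose H z := \sum_(v < k) e (lift ord0 v) (z i) * h (lift ord0 v) z.
pose S2 z := \sum_(v < k) normc (h (lift ord0 v) z) ^+ 2.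
pose S4 z := \sum_(v < k) normc (h (lift ord0 v) z) ^+ 4.
pose M := \sum_(v < k) N (lift ord0 v).
have M0 : 0 <= M by rewrite sumr_ge0.
have kK : k%:R <= K by rewrite ler_nat.
have H2 z : normc (H z) ^+ 2 <= K * S2 z.
  apply: le_trans (_ : (\sum_(v < k) normc (h (lift ord0 v) z)) ^+ 2 <= _).
    have n0 : 0 <= \sum_(v < k) normc (h (lift ord0 v) z).
      by rewrite sumr_ge0 // => v _; exact: normc_ge0.
    rewrite lerXn2r ?nnegrE ?normc_ge0 //.
    apply: le_trans (normc_sum_le _ _ _) _; apply: ler_sum => v _.
    by rewrite Normc.normcM ler_piMl ?normc_ge0.
  apply: le_trans (sqr_sum_le _) _; rewrite card_ord ler_wpM2r // sumr_ge0 // => v _.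
  by rewrite sqr_ge0.
have H4 z : normc (H z) ^+ 4 <= K ^+ 3 * S4 z.
  have e4 (a : R) : a ^+ 4 = (a ^+ 2) ^+ 2 by rewrite -exprM.
  have S20 : 0 <= S2 z by rewrite sumr_ge0 // => v _; rewrite sqr_ge0.
  have S40 : 0 <= S4 z by rewrite sumr_ge0 // => v _; rewrite exprn_ge0 ?normc_ge0.
  rewrite e4; apply: le_trans (_ : (K * S2 z) ^+ 2 <= _).
    by rewrite lerXn2r ?nnegrE ?sqr_ge0 ?mulr_ge0 //; lra.
  rewrite exprMn [K ^+ 3]exprSr -mulrA ler_wpM2l ?sqr_ge0 //.
  apply: le_trans (sqr_sum_le _) _; rewrite card_ord.
  under eq_bigr do rewrite -e4.
  by rewrite ler_wpM2r.
have cross : \sum_(z : Z) normc (g z) ^+ 2 * Re ((g z)^* * H z) = 0.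
  have hz v : \sum_(z : Z) (normc (g z) ^+ 2)%:C * (g z)^* * h (lift ord0 v) z *
                    e (lift ord0 v) (z i) = 0.
    apply: (sum_mean_zero (phi := fun z => _ * _ * h (lift ord0 v) z)).
      by move=> z w; rewrite /g !hind.
    by rewrite (sum_system eP) muln0.
  transitivity (Re (\sum_(v < k) \sum_(z : Z) (normc (g z) ^+ 2)%:C * (g z)^* *
                      h (lift ord0 v) z * e (lift ord0 v) (z i))).
    rewrite exchange_big raddf_sum; apply: eq_bigr => z _ /=.
    transitivity (Re ((normc (g z) ^+ 2)%:C * ((g z)^* * H z))).
      by case: (_^* * _) => a b /=; rewrite mul0r subr0.
    congr Re; rewrite /H !mulr_sumr; apply: eq_bigr => v _.
    by rewrite !mulrA mulrAC.
  by rewrite big1.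
have mixed : \sum_(z : Z) normc (g z) ^+ 2 * S2 z <= #|Z|%:R * (N ord0 * M).
  under eq_bigr do rewrite mulr_sumr.
  rewrite exchange_big /= /M !mulr_sumr; apply: ler_sum => v _.
  have hs u : 0 <= Num.sqrt #|Z|%:R * N u by rewrite mulr_ge0 ?sqrtr_ge0.
  have hq u : \sum_(z : Z) (normc (h u z) ^+ 2) ^+ 2 <= (Num.sqrt #|Z|%:R * N u) ^+ 2.
    by under eq_bigr do rewrite -exprM; rewrite exprMn sqr_sqrtr.
  apply: le_trans (sum_CauchySchwarz (hs ord0) (hs (lift ord0 v)) (hq _) (hq _)) _.
  by rewrite mulrACA -expr2 sqr_sqrtr.
have quartic : \sum_(z : Z) S4 z <= #|Z|%:R * M ^+ 2.
  rewrite exchange_big /=.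
  apply: le_trans (ler_sum _ (fun v _ => hN (lift ord0 v))) _.
  rewrite -mulr_sumr ler_wpM2l // expr2 {1}/M mulr_suml; apply: ler_sum => v _.
  rewrite expr2 ler_wpM2l // /M (bigD1 v) //= lerDl sumr_ge0 //.
apply: le_trans (_ : \sum_(z : Z) (normc (g z) ^+ 4
    + 4 * (normc (g z) ^+ 2 * Re ((g z)^* * H z))
    + 8 * K * (normc (g z) ^+ 2 * S2 z) + 3 * K ^+ 3 * S4 z) <= _).
  apply: ler_sum => z _; rewrite big_ord_recl e0 mul1r.
  apply: le_trans (normc_add_exp4 _ _) _; rewrite -/(H z) -/(g z) -addrA -[leRHS]addrA.
  rewrite lerD2l lerD //; last by rewrite -[leRHS]mulrA ler_wpM2l.
  rewrite -[leRHS]mulrA ler_wpM2l // [leRHS]mulrCA ler_wpM2l ?sqr_ge0 //.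
rewrite !big_split /= -!mulr_sumr cross mulr0 addr0.
rewrite big_ord_recl /= expr0 mul1r.
rewrite -mulr_sumr -/M [L ^+ _]expr1.
have c0 : 0 <= #|Z|%:R :> R by [].
have K3 : K ^+ 3 <= K ^+ 4 by rewrite ler_weXn2l.
have K30 : 0 <= K ^+ 3 by rewrite exprn_ge0.
have K2 : K <= K ^+ 2 by rewrite ler_eXnr.
have NM : 0 <= N ord0 * M by rewrite mulr_ge0.
(* This is the expanded square of [N ord0 + L * M] with L = 4 K^2. *)
apply: le_trans (_ : #|Z|%:R * (N ord0 ^+ 2 + 8 * K ^+ 2 * (N ord0 * M)
                       + 16 * K ^+ 4 * M ^+ 2) <= _); last first.
  by rewrite le_eqVlt; apply/orP; left; apply/eqP; rewrite /L -/K; ring.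
rewrite !mulrDr; apply: lerD; first (apply: lerD; first exact: hN).
  rewrite [leRHS]mulrCA; apply: ler_pM mixed => //; last by rewrite ler_wpM2l.
    by lra.
  rewrite sumr_ge0 // => z _; rewrite mulr_ge0 ?sqr_ge0 // sumr_ge0 // => v _.
  by rewrite sqr_ge0.
rewrite [leRHS]mulrCA; apply: ler_pM quartic => //.
- by rewrite mulr_ge0.
- by rewrite sumr_ge0 // => z _; rewrite sumr_ge0 // => v _; rewrite exprn_ge0 ?normc_ge0.
- lra.
Qed.

Definition agree_off s beta alpha := [forall j, (j \notin s) ==> (alpha j == beta j)].

Lemma agree_off_cons i s beta alpha v : i \notin s ->
  agree_off (i :: s) beta alpha && (alpha i == v) =
  agree_off s [ffun j => if j == i then v else beta j] alpha.
Proof.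
move=> his; apply/andP/forallP => [[/forallP h /eqP hv] j|h].
  apply/implyP => hj; rewrite ffunE; have [->|ji] := eqVneq j i; first by rewrite hv.
  by have := h j; rewrite inE negb_or ji hj.
split; last by have := h i; rewrite his ffunE eqxx.
apply/forallP => j; apply/implyP; rewrite inE negb_or => /andP[ji hj].
by have := h j; rewrite hj ffunE (negbTE ji).
Qed.

(* Freezing alpha off s at the values of beta lets the induction on s split the
   sum according to the value of alpha at one coordinate, without reindexing. *)
Lemma hypercontractive_seq c s beta : uniq s ->
  \sum_(z : Z) normc (\sum_(alpha | agree_off s beta alpha)
                  c alpha * \prod_(i <- s) e (alpha i) (z i)) ^+ 4 <=
  #|Z|%:R * (\sum_(alpha | agree_off s beta alpha)
       L ^+ (\sum_(i <- s) (alpha i != ord0)) * normc (c alpha) ^+ 2) ^+ 2.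
Proof.
have L0 : 0 <= L by rewrite mulr_ge0 ?sqr_ge0.
elim: s beta => [|i s IH] beta; last move=> /= /andP[his us].
  (* With every coordinate frozen only the index [beta] is left, and the two sides are equal. *)
  move=> _; have eb : agree_off [::] beta =1 pred1 beta.
    move=> alpha; apply/forallP/eqP => [h|-> j]; last by rewrite eqxx implybT.
    by apply/ffunP => j; apply/eqP; have := h j.
  under eq_bigr do rewrite (big_pred1 _ eb) big_nil mulr1.
  by rewrite (big_pred1 _ eb) big_nil expr0 mul1r sumr_const -[leLHS]mulr_natl -exprM lexx.
pose b v : {ffun I -> 'I_k.+1} := [ffun j => if j == i then v else beta j].
pose h v z := \sum_(alpha | agree_off s (b v) alpha)
                  c alpha * \prod_(i <- s) e (alpha i) (z i).
pose N v := \sum_(alpha | agree_off s (b v) alpha)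
       L ^+ (\sum_(i <- s) (alpha i != ord0)) * normc (c alpha) ^+ 2.
have -> : \sum_(alpha | agree_off (i :: s) beta alpha)
    L ^+ (\sum_(j <- i :: s) (alpha j != ord0)) * normc (c alpha) ^+ 2 =
    \sum_v L ^+ (v != ord0) * N v.
  rewrite (partition_big (fun alpha => alpha i) predT) //=; apply: eq_bigr => v _.
  rewrite mulr_sumr; under eq_bigl do rewrite agree_off_cons //.
  apply: eq_bigr => alpha ha; rewrite big_cons exprD mulrA.
  by move: ha; rewrite -agree_off_cons // => /andP[_ /eqP ->].
rewrite (eq_bigr (fun z => normc (\sum_v e v (z i) * h v z) ^+ 4)); last first.
  move=> z _; congr (normc _ ^+ 4).
  rewrite (partition_big (fun alpha => alpha i) predT) //=; apply: eq_bigr => v _.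
  rewrite mulr_sumr; under eq_bigl do rewrite agree_off_cons //.
  apply: eq_bigr => alpha ha; rewrite big_cons mulrCA.
  by move: ha; rewrite -agree_off_cons // => /andP[_ /eqP ->].
apply: hypercontractive_step => [v z w|v|v]; last exact: IH.
- apply: eq_bigr => alpha _; congr (_ * _); apply: eq_big_seq => j hj.
  by rewrite ffunE; case: eqP => // ji; rewrite -ji hj in his.
- by apply: sumr_ge0 => alpha _; rewrite mulr_ge0 ?exprn_ge0 ?normc_ge0.
Qed.

(** The case where no coordinate is frozen. Each active coordinate costs a factor [L], so support
    size at most d costs at most L^d. *)
Lemma hypercontractive c : \sum_(z : Z) normc (expansion e c z) ^+ 4 <=
  #|Z|%:R * (\sum_alpha L ^+ supp_size alpha * normc (c alpha) ^+ 2) ^+ 2.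
Proof.
have [beta _|no] := pickP (fun _ : {ffun I -> 'I_k.+1} => true); last first.
  by move: (no [ffun=> ord0]).
have eb : agree_off (index_enum I) beta =1 predT.
  by move=> alpha; apply/forallP => j; rewrite mem_index_enum.
have := hypercontractive_seq c beta (index_enum_uniq I).
congr (_ <= _ * _ ^+ 2).
  by apply: eq_bigr => z _; rewrite (eq_bigl _ _ eb).
rewrite (eq_bigl _ _ eb); apply: eq_bigr => alpha _; congr (L ^+ _ * _).
rewrite /supp_size -sum1_card [RHS]big_mkcond; apply: eq_bigr => i _.
by rewrite inE; case: (alpha i == ord0).
Qed.

End Hypercontractivity.

(** * The Bohnenblust-Hille inequality *)

Section BohnenblustHille.
Variables (R : realType) (T I : finType) (k d : nat) (e : 'I_k.+1 -> T -> R[i]).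
Hypothesis eP : bounded_orthonormal e.
Local Notation Z := {ffun I -> T}.
Implicit Types (alpha : {ffun I -> 'I_k.+1}) (z : Z).
Implicit Types c : {ffun I -> 'I_k.+1} -> R[i].

Let L : R := 4 * k.+1%:R ^+ 2.

Let L1 : 1 <= L.
Proof.
have : 1 <= k.+1%:R ^+ 2 :> R by rewrite exprn_ege1 // ler1n.
rewrite /L; lra.
Qed.

Let L0 : 0 <= L. Proof. exact: le_trans ler01 L1. Qed.

(** Hypercontractivity bounds the L4 norm by the L2 norm, and interpolating L2 between L1 and L4
    then bounds L2 by L1. *)
Lemma L2_le_L1 c : (forall alpha, (d < supp_size alpha)%N -> c alpha = 0) ->
  #|Z|%:R * Num.sqrt (\sum_alpha normc (c alpha) ^+ 2) <=
  3 * L ^+ d * \sum_(z : Z) normc (expansion e c z).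
Proof.
move=> hd; set S := \sum_alpha _; set q := Num.sqrt S; set Q := #|Z|%:R.
have S0 : 0 <= S by rewrite sumr_ge0 // => alpha _; rewrite sqr_ge0.
have q2 : q ^+ 2 = S by rewrite sqr_sqrtr.
have Ld : 0 < L ^+ d by rewrite exprn_gt0 // (lt_le_trans _ L1).
have X0 : 0 <= \sum_(z : Z) normc (expansion e c z).
  by rewrite sumr_ge0 // => z _; exact: normc_ge0.
have [q0|qn] := eqVneq q 0; first by rewrite q0 mulr0 !mulr_ge0 // ltW.
have qpos : 0 < q by rewrite lt_neqAle eq_sym qn sqrtr_ge0.
(* With this threshold the quartic term is a quarter of the left-hand side, which leaves 3 Q q <= 8
   L^d X; the factor 8/3 is rounded up to 3. *)
pose a := 2 * L ^+ d * q; have a0 : 0 < a by rewrite !mulr_gt0.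
(* An elementary form of Hoelder's inequality between the exponents 1, 2 and 4. *)
have pt x : 0 <= x -> a ^+ 2 * x ^+ 2 <= a ^+ 3 * x + x ^+ 4.
  move=> x0; have [xa|/ltW ax] := leP x a.
    rewrite -[leLHS]addr0 lerD ?exprn_ge0 //.
    rewrite -subr_ge0 (_ : _ - _ = a ^+ 2 * x * (a - x)); last by ring.
    by rewrite mulr_ge0 ?subr_ge0 // mulr_ge0 ?sqr_ge0.
  have aa := ltW a0; rewrite -[leLHS]add0r lerD //.
    by rewrite mulr_ge0 ?exprn_ge0.
  by rewrite (exprD x 2 2) ler_wpM2r ?sqr_ge0 // lerXn2r ?nnegrE.
have h4 : \sum_(z : Z) normc (expansion e c z) ^+ 4 <= Q * (L ^+ d * S) ^+ 2.
  apply: le_trans (hypercontractive eP c) _; rewrite -/L ler_wpM2l //.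
  have lS : \sum_alpha L ^+ supp_size alpha * normc (c alpha) ^+ 2 <= L ^+ d * S.
    rewrite mulr_sumr; apply: ler_sum => alpha _.
    have [hs|/hd ->] := leqP (supp_size alpha) d; last by rewrite Normc.normc0 expr0n !mulr0.
    by rewrite ler_wpM2r ?sqr_ge0 // ler_weXn2l.
  rewrite lerXn2r ?nnegrE // ?mulr_ge0 // ?(ltW Ld) // sumr_ge0 // => alpha _.
  by rewrite mulr_ge0 ?sqr_ge0 // exprn_ge0.
have := parseval eP c; rewrite -/S -/Q => h2.
have : a ^+ 2 * (Q * S) <= a ^+ 3 * (\sum_(z : Z) normc (expansion e c z)) +
    Q * (L ^+ d * S) ^+ 2.
  apply: le_trans (lerD (lexx _) h4); rewrite -h2 !mulr_sumr.
  by rewrite -big_split /=; apply: ler_sum => z _; apply: pt; exact: normc_ge0.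
set X := \sum_(z : Z) _ in X0 *; rewrite -q2 => h.
have h' : a ^+ 3 * (3 * (Q * q)) <= a ^+ 3 * (8 * (L ^+ d * X)).
  have -> : a ^+ 3 * (3 * (Q * q)) =
      8 * L ^+ d * (a ^+ 2 * (Q * q ^+ 2) - Q * (L ^+ d * q ^+ 2) ^+ 2).
    by rewrite /a; ring.
  have -> : a ^+ 3 * (8 * (L ^+ d * X)) = 8 * L ^+ d * (a ^+ 3 * X) by ring.
  by rewrite ler_wpM2l ?mulr_ge0 ?(ltW Ld) // lerBlDr.
rewrite ler_pM2l ?exprn_gt0 // in h'.
have LX : 0 <= L ^+ d * X by rewrite mulr_ge0 // ltW.
by rewrite -[leRHS]mulrA; lra.
Qed.

(** The 12 is the 3 of [L2_le_L1] times the 4 of [sum_normc_coord_part_le]. *)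
Let W : R := 12 * L ^+ d * ((d ^ 2).+1%:R * 16 ^+ (d ^ 2)).

Lemma sum_influence_le c (M : R) : (0 < #|Z|)%N ->
  (forall alpha, (d < supp_size alpha)%N -> c alpha = 0) ->
  (forall z, normc (expansion e c z) <= M) ->
  \sum_i Num.sqrt (\sum_(alpha : {ffun I -> 'I_k.+1} | alpha i != ord0)
                     normc (c alpha) ^+ 2) <= W * M.
Proof.
move=> Z0 hd hM; have Q0 : 0 < #|Z|%:R :> R by rewrite ltr0n.
rewrite -(ler_pM2l Q0) mulr_sumr.
apply: le_trans (_ : \sum_i 3 * L ^+ d *
    (\sum_(z : Z) normc (expansion e (coord_part i c) z)) <= _).
  apply: ler_sum => i _.
  have hdi alpha : (d < supp_size alpha)%N -> coord_part i c alpha = 0.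
    by move/hd=> h; rewrite /coord_part; case: ifP.
  apply: le_trans (L2_le_L1 hdi); rewrite ler_wpM2l // ler_wsqrtr //.
  rewrite big_mkcond /=; apply: ler_sum => alpha _; rewrite /coord_part.
  by case: ifP => //; rewrite sqr_ge0.
rewrite -mulr_sumr exchange_big /=.
apply: le_trans (_ : 3 * L ^+ d * \sum_(z : Z)
    4 * ((d ^ 2).+1%:R * 16 ^+ (d ^ 2) * M) <= _).
  rewrite ler_wpM2l ?mulr_ge0 ?exprn_ge0 //.
  by apply: ler_sum => z _; exact: sum_normc_coord_part_le.
by rewrite sumr_const -mulr_natl le_eqVlt; apply/orP; left; apply/eqP; rewrite /W; ring.
Qed.

(** By Parseval the squared moduli of the coefficients add up to the mean square of f. *)
Lemma normc_coef_le c (M : R) alpha : (0 < #|Z|)%N ->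
  (forall z, normc (expansion e c z) <= M) -> normc (c alpha) <= M.
Proof.
move=> Z0 hM; have Q0 : 0 < #|Z|%:R :> R by rewrite ltr0n.
have [z _] := card_gt0P Z0; have M0 := le_trans (normc_ge0 _) (hM z).
rewrite -(@ler_pXn2r _ 2) ?nnegrE ?normc_ge0 //.
apply: le_trans (_ : \sum_alpha normc (c alpha) ^+ 2 <= _).
  by rewrite (bigD1 alpha) //= lerDl sumr_ge0 // => beta _; rewrite sqr_ge0.
rewrite -(ler_pM2l Q0) -(parseval eP) mulr_natl -sumr_const.
by apply: ler_sum => y _; rewrite lerXn2r ?nnegrE ?normc_ge0.
Qed.

Lemma bohnenblust_hille c (M : R) : (0 < d)%N -> (0 < #|Z|)%N ->
  (forall alpha, (d < supp_size alpha)%N -> c alpha = 0) ->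
  (forall z, normc (expansion e c z) <= M) ->
  (\sum_alpha normc (c alpha) `^ (2 * d%:R / (d%:R + 1)))
    `^ ((d%:R + 1) / (2 * d%:R)) <= W * (1 + expR k%:R) * M.
Proof.
move=> d0 Z0 hd hM.
have [z _] := card_gt0P Z0; have M0 := le_trans (normc_ge0 _) (hM z).
have dR : 1 <= d%:R :> R by rewrite ler1n.
set p := _ / _; set r := _ / _.
have p0 : 0 < p by rewrite divr_gt0 ?mulr_gt0 ?ltr0n // natr1 ltr0n.
have r0 : 0 < r by rewrite divr_gt0 ?mulr_gt0 ?ltr0n // natr1 ltr0n.
have pr : p * r = 1 by rewrite /p /r; field; rewrite pnatr_eq0 -lt0n d0 natr1 pnatr_eq0.
have r1 : r <= 1 by rewrite ler_pdivrMr ?mulr_gt0 ?ltr0n //; lra.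
have C1 : 1 <= 1 + expR k%:R :> R by rewrite lerDl expR_ge0.
have W1 : 1 <= W.
  rewrite /W -[leLHS]mulr1 ler_pM //; last first.
    by rewrite -[leLHS]mulr1 ler_pM // ?ler1n ?exprn_ege1 ?ler1n.
  by have : 1 <= L ^+ d by [rewrite exprn_ege1]; lra.
have [Mz|Mn] := eqVneq M 0.
  rewrite big1 => [|alpha _]; first by rewrite powR0 ?gt_eqF // Mz mulr0.
  have -> : normc (c alpha) = 0.
    by apply/eqP; rewrite eq_le normc_ge0 -Mz normc_coef_le.
  by rewrite powR0 // gt_eqF.
have Mpos : 0 < M by rewrite lt_neqAle eq_sym Mn.
have WM : 0 < W * M by rewrite mulr_gt0 // (lt_le_trans _ W1).
(* This scaling meets both hypotheses of [blei]: coefficients at most 1, as W >= 1, and influences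
   of sum at most 1. Since p r = 1, the factor W M comes back unchanged. *)
pose b alpha := normc (c alpha) / (W * M).
have b0 alpha : 0 <= b alpha by rewrite divr_ge0 ?normc_ge0 // ltW.
have b1 alpha : b alpha <= 1.
  rewrite ler_pdivrMr // mul1r; apply: le_trans (normc_coef_le alpha Z0 hM) _.
  by rewrite ler_peMl.
have bd alpha : (d < supp_size alpha)%N -> b alpha = 0.
  by move/hd => h; rewrite /b h Normc.normc0 mul0r.
have hB : \sum_i Num.sqrt (\sum_(alpha : {ffun I -> 'I_k.+1} | alpha i != ord0) b alpha ^+ 2) <= 1.
  have := sum_influence_le Z0 hd hM.
  rewrite -[leRHS]mul1r -(ler_pdivrMr _ _ WM) mulr_suml => hs.
  apply: le_trans hs; rewrite le_eqVlt; apply/orP; left; apply/eqP.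
  apply: eq_bigr => i _; under eq_bigr do rewrite expr_div_n.
  rewrite -mulr_suml sqrtrM; last by rewrite sumr_ge0 // => *; rewrite sqr_ge0.
  by rewrite -exprVn sqrtr_sqr ger0_norm // invr_ge0 ltW.
have hb := blei b0 b1 d0 bd hB.
have -> : \sum_alpha normc (c alpha) `^ p =
    (W * M) `^ p * \sum_alpha b alpha `^ p.
  rewrite mulr_sumr; apply: eq_bigr => alpha _.
  by rewrite -powRM ?(ltW WM) // /b mulrCA mulfV ?mulr1 ?gt_eqF.
have s0 : 0 <= \sum_alpha b alpha `^ p by rewrite sumr_ge0 // => *; exact: powR_ge0.
rewrite powRM ?powR_ge0 // -powRrM pr powRr1 ?(ltW WM) //.
rewrite [leRHS]mulrAC ler_pM ?powR_ge0 ?(ltW WM) //.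
apply: le_trans (_ : (1 + expR k%:R) `^ r <= _); last exact: ler1_powR.
by apply: ge0_ler_powR; rewrite ?nnegrE ?(ltW r0) // (le_trans s0 hb).
Qed.

(** Here 384 = 12 * 2 * 16, where the 2 pays for d^2 + 1 <= 2^(d^2); the other factors only grow
    when raised to the power d^2. *)
Lemma bohnenblust_hille_constant_le : (0 < d)%N ->
  W * (1 + expR k%:R) <= (384 * L * (1 + expR k%:R)) ^+ (d ^ 2).
Proof.
move=> d0; have C1 : 1 <= 1 + expR k%:R :> R by rewrite lerDl expR_ge0.
have d2 : (0 < d ^ 2)%N by rewrite expn_gt0 d0.
have ege (x : R) : 1 <= x -> x <= x ^+ (d ^ 2).
  by move=> x1; rewrite -{1}[x]expr1 ler_weXn2l.
have -> : (384 : R) = 12 * 2 * 16 by ring.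
rewrite 4!exprMn /W [12 * L ^+ d * _]mulrACA [12 * _]mulrC.
set x := 1 + _ in C1 *.
have -> : 12 ^+ (d ^ 2) * 2 ^+ (d ^ 2) * 16 ^+ (d ^ 2) * L ^+ (d ^ 2) * x ^+ (d ^ 2) =
   2 ^+ (d ^ 2) * 12 ^+ (d ^ 2) * (L ^+ (d ^ 2) * 16 ^+ (d ^ 2)) * x ^+ (d ^ 2) by ring.
have e0 (y : R) n : 0 <= y -> 0 <= y ^+ n by exact: exprn_ge0.
have x0 : 0 <= x by lra.
rewrite ler_pM ?ege ?mulr_ge0 ?e0 //.
rewrite ler_pM ?mulr_ge0 ?e0 //.
  rewrite ler_pM ?ege //; last by lra.
  by rewrite -natrX ler_nat ltn_expl.
rewrite ler_wpM2r ?e0 // ler_weXn2l //.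
by rewrite -mulnn leq_pmulr.
Qed.

End BohnenblustHille.

(** * Roots of unity *)

Section RootsOfUnity.
Variables (R : realType) (k : nat).
Local Notation omega := (omega R k.+1).
Local Notation Omega := (Omega R k.+1).

Lemma omegaX n : omega ^+ n =
  cos (n%:R * (2 * pi / k.+1%:R)) +i* sin (n%:R * (2 * pi / k.+1%:R)).
Proof.
rewrite /Defs.omega; move: (2 * pi / _) => t.
elim: n => [|n IH]; first by rewrite mul0r cos0 sin0.
have -> : n.+1%:R * t = n%:R * t + t by rewrite -natr1 mulrDl mul1r.
by rewrite exprS IH cosD sinD; congr (_ +i* _); ring.
Qed.

Lemma omega_conj_mul : omega * omega^* = 1.
Proof.
apply/eqP; rewrite eq_complex /= mulrN opprK -!expr2 cos2Dsin2 eqxx /=.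
by rewrite mulrN mulrC addNr.
Qed.

Lemma normc_omega : normc omega = 1.
Proof. by rewrite /= cos2Dsin2 sqrtr1. Qed.

(** Otherwise cos (2x) = 1 for x = n pi / K, which lies strictly between 0 and pi, where the sine is
    positive. *)
Lemma omegaX_neq1 n : (0 < n < k.+1)%N -> omega ^+ n != 1.
Proof.
move=> /andP[n0 nk]; apply/eqP => h.
pose x : R := n%:R * (pi / k.+1%:R).
have : cos (x + x) = 1.
  have -> : x + x = n%:R * (2 * pi / k.+1%:R) by rewrite /x; ring.
  by have := congr1 (@complex.Re R) h; rewrite omegaX.
have : 0 < sin x.
  apply: sin_gt0_pi; rewrite mulr_gt0 ?divr_gt0 ?pi_gt0 ?ltr0n //=.
  rewrite /x mulrCA gtr_pMr ?pi_gt0 // ltr_pdivrMr ?ltr0n // mul1r ltr_nat.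
  by [].
rewrite cosD => s0; have := cos2Dsin2 x; have := mulr_gt0 s0 s0.
rewrite !expr2; lra.
Qed.

Lemma omega_prim : k.+1.-primitive_root omega.
Proof.
apply/andP; split => //; apply/forallP => i; rewrite unity_rootE; apply/eqP.
have [e|ne] := eqVneq i.+1 k.+1; last first.
  by apply/negbTE/omegaX_neq1; rewrite /= ltn_neqAle ne ltn_ord.
have -> : i.+1 = k.+1 by [].
rewrite omegaX mulrC divfK ?pnatr_eq0 // mulr_natl cos2pi sin2pi.
by rewrite eqxx.
Qed.

Lemma omegaX_mem (j : 'I_k.+1) :
  omega ^+ j \in [seq omega ^+ n | n <- iota 0 k.+1].
Proof. by apply: map_f; rewrite mem_iota /= add0n ltn_ord. Qed.

Definition omega_pow (j : 'I_k.+1) : Omega := SeqSub (omegaX_mem j).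

Lemma omega_pow_bij : bijective omega_pow.
Proof.
have inj : injective omega_pow.
  move=> i j [] /eqP; rewrite (eq_prim_root_expr omega_prim) !modn_small ?ltn_ord //.
  by move/eqP/val_inj.
(* [seq_sub] forgets repetitions, so counting its elements needs distinct powers. *)
apply: inj_card_bij => //; rewrite card_ord card_seq_sub ?size_map ?size_iota //.
rewrite map_inj_in_uniq ?iota_uniq // => m n; rewrite !mem_iota /= !add0n => hm hn.
by move/eqP; rewrite (eq_prim_root_expr omega_prim) !modn_small // => /eqP.
Qed.

Lemma card_Omega : #|Omega| = k.+1.
Proof. by rewrite -(bij_eq_card omega_pow_bij) card_ord. Qed.

Lemma Omega_bounded_orthonormal :
  bounded_orthonormal (fun (v : 'I_k.+1) (w : Omega) => val w ^+ v).
Proof.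
have normX (y : R[i]) n : normc (y ^+ n) = normc y ^+ n.
  by elim: n => [|n IH]; rewrite ?Normc.normc1 // !exprS Normc.normcM IH.
have [g gK Kg] := omega_pow_bij.
split=> [//|v w|u v].
  by rewrite -(Kg w) /= !normX normc_omega !expr1n.
rewrite card_Omega (reindex omega_pow) /=; last exact: onW_bij omega_pow_bij.
(* Orthogonality is a geometric sum of ratio [eta], a K-th root of unity equal to 1 only for u =
   v. *)
pose eta := omega ^+ u * (omega ^+ v)^*.
rewrite (eq_bigr (fun j : 'I_k.+1 => eta ^+ j)) => [|j _]; last first.
  by rewrite /eta exprMn !rmorphXn /= -!exprM mulnC [(j * v)%N]mulnC.
have unit n : omega ^+ n * (omega ^+ n)^* = 1.
  by rewrite rmorphXn -exprMn omega_conj_mul expr1n.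
have [uv|ne] := eqVneq u v.
  rewrite muln1 /eta uv unit.
  by under eq_bigr do rewrite expr1n; rewrite sumr_const card_ord.
have : (eta - 1) * \sum_(j < k.+1) eta ^+ j = 0.
  rewrite -subrX1 /eta exprMn rmorphXn -!exprM mulnC exprM (prim_expr_order omega_prim).
  rewrite expr1n mul1r -rmorphXn mulnC exprM (prim_expr_order omega_prim) expr1n.
  by rewrite rmorph1 subrr.
move/eqP; rewrite mulf_eq0 => /orP[|/eqP ->]; last by rewrite muln0.
rewrite subr_eq0 => /eqP h; case/eqP: ne; apply: val_inj; apply/eqP.
have : omega ^+ u == omega ^+ v.
  have := congr1 (fun x => omega ^+ v * x) h.
  by rewrite /eta mulrCA unit !mulr1 => ->.
by rewrite (eq_prim_root_expr omega_prim) !modn_small ?ltn_ord.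
Qed.

End RootsOfUnity.

(** * Transfer to functions on the cyclic groups *)

Section CyclicGroups.
Variables (R : realType).

Lemma normc_le_sup_norm n K (f : {ffun 'I_n -> Omega R K} -> R[i]) z :
  normc (f z) <= sup_norm f.
Proof.
apply: sup_ubound; last by exists z.
(* The domain is finite, so the sum of all moduli is an upper bound. *)
exists (\sum_y normc (f y)) => _ [y _ <-].
by rewrite (bigD1 y) //= lerDl sumr_ge0 // => *; exact: normc_ge0.
Qed.

(** A nonzero exponent is at least 1. This turns the bound on the degree into one on the support. *)
Lemma supp_size_le_mdeg n k (alpha : multi_index n k.+1) :
  (supp_size alpha <= mdeg alpha)%N.
Proof.
rewrite /supp_size -sum1_card big_mkcond; apply: leq_sum => i _.
by rewrite inE -val_eqE /=; case: (nat_of_ord _).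
Qed.

Lemma BH_inequality_cyclic d k : (0 < d)%N ->
  BH_inequality d k.+1
    ((384 * (4 * k.+1%:R ^+ 2) * (1 + expR k%:R)) ^+ (d ^ 2) : R).
Proof.
(* The values of [a] above degree d are arbitrary; truncating them gives coefficients whose full
   expansion is f. *)
move=> d0 n f a _ _ hf; pose c alpha := if (mdeg alpha <= d)%N then a alpha else 0.
set e := fun (v : 'I_k.+1) (w : Omega R k.+1) => val w ^+ v.
have fE z : expansion e c z = f z.
  rewrite hf big_mkcond; apply: eq_bigr => alpha _; rewrite /c.
  by case: ifP => _; rewrite ?mul0r.
have hd alpha : (d < supp_size alpha)%N -> c alpha = 0.
  move=> h; rewrite /c leqNgt (leq_trans h) //; exact: supp_size_le_mdeg.
have Z0 : (0 < #|{ffun 'I_n -> Omega R k.+1}|)%N.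
  by rewrite card_ffun card_Omega expn_gt0.
have hM z : normc (expansion e c z) <= sup_norm f by rewrite fE normc_le_sup_norm.
have [z _] := card_gt0P Z0; have M0 := le_trans (normc_ge0 _) (hM z).
have := bohnenblust_hille (@Omega_bounded_orthonormal R k) d0 Z0 hd hM.
rewrite (_ : \sum_alpha _ = \sum_(alpha | (mdeg alpha <= d)%N)
    normc (a alpha) `^ (2 * d%:R / (d%:R + 1))) => [h|].
  apply: le_trans h _; rewrite ler_wpM2r //.
  exact: bohnenblust_hille_constant_le.
rewrite [RHS]big_mkcond; apply: eq_bigr => alpha _; rewrite /c; case: ifP => // _.
rewrite Normc.normc0 powR0 // mulf_neq0 ?invr_eq0 ?natr1 ?pnatr_eq0 //.
by rewrite mulf_neq0 ?pnatr_eq0 // -lt0n.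
Qed.

End CyclicGroups.

Theorem theorem1 (R : realType) :
  (forall d K : nat, (1 <= d)%N -> (2 < K)%N ->
     exists C : R, 0 < C /\ BH_inequality d K C)
  /\
  (forall K : nat, (2 < K)%N -> prime K ->
     exists CK : R, 0 < CK /\
       forall d : nat, (1 <= d)%N -> BH_inequality d K (CK ^+ (d ^ 2))).
Proof.
(* The base C_K for K = k + 1. *)
pose C k : R := 384 * (4 * k.+1%:R ^+ 2) * (1 + expR k%:R).
have C0 k : 0 < C k.
  by rewrite mulr_gt0 // ?mulr_gt0 ?exprn_gt0 // addr_gt0 ?expR_gt0.
split=> [d [//|k] d0 _|[//|k] _ _].
  exists (C k ^+ (d ^ 2)); split; first exact: exprn_gt0.
  exact: BH_inequality_cyclic.
by exists (C k); split=> // d d0; exact: BH_inequality_cyclic.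
Qed.
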